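(* Let $q$ be a prime power, let $e_1\ge e_2\ge 1$ be integers and put $d=e_1+e_2$. For $i\in\{1,2\}$ let $X_i$ be the set of $e_i$-dimensional subspaces of $V=(\mathbb F_q)^d$, let $Y_i\subseteq X_i$ be non-empty, and put $\alpha_i=|Y_i|/|X_i|$. Then $\alpha_1\alpha_2>0$ and $$\frac{|\{(S_1,S_2)\in Y_1\times Y_2 : S_1\cap S_2=\{0\}\}|}{|Y_1|\cdot|Y_2|}\ \ge\ \frac{q^{e_1e_2}}{\genfrac{[}{]}{0pt}{}{d}{e_1}_q}\left(1-\sqrt{\left(\tfrac{1}{\alpha_1}-1\right)\left(\tfrac{1}{\alpha_2}-1\right)}\;q^{-\frac d2}\right).$$ Suppose moreover that $\min\{\alpha_1,\alpha_2\}\ge\alpha>0$ and let $\omega_q(e)=\prod_{i=1}^{e}(1-q^{-i})$. Then $$\frac{|\{(S_1,S_2)\in Y_1\times Y_2 : S_1\cap S_2=\{0\}\}|}{|Y_1|\cdot|Y_2|}\ >\ \omega_q(e_2)\left(1-\left(\frac1\alpha-1\right)q^{-\frac d2}\right).$$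
   Context: $\genfrac{[}{]}{0pt}{}{a}{b}_q=\prod_{i=0}^{b-1}\frac{q^{a-i}-1}{q^{b-i}-1}$ is the Gaussian binomial coefficient, i.e. the number of $b$-dimensional subspaces of $(\mathbb F_q)^a$.
   Formalization: The last strict inequality fails when α1=α2=α and (1/α−1)q^{-d/2}=1 (e.g. e1=e2=1, Y1=Y2={L}, α=1/(q+1): both sides are 0); the formal theorem proves ≥ always and > in every case except that one. *)

(* Defs.v *)
From HB Require Import structures.
From mathcomp Require Import all_boot all_order all_algebra.
From mathcomp Require Import reals exp.

Set Implicit Arguments.
Unset Strict Implicit.
Unset Printing Implicit Defensive.

Import Order.TTheory GRing.Theory Num.Theory.
Local Open Scope ring_scope.

Section VspaceFinite.

(* [vs2mx], the subtype projection of [{vspace vT}], is only canonical here. *)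
Import VectorInternalTheory.

Variables (F : finFieldType) (vT : vectType F).

HB.instance Definition _ := [Finite of {vspace vT} by <:].

End VspaceFinite.

Definition subspaces (F : finFieldType) (d e : nat) : {set {vspace 'rV[F]_d}} :=
  [set S | \dim S == e].

Definition density (R : realType) (T : finType) (Y X : {set T}) : R :=
  #|Y|%:R / #|X|%:R.

Definition disjoint_pairs (F : finFieldType) (d : nat)
    (Y1 Y2 : {set {vspace 'rV[F]_d}}) :
    {set {vspace 'rV[F]_d} * {vspace 'rV[F]_d}} :=
  [set S in setX Y1 Y2 | (S.1 :&: S.2)%VS == 0%VS].

(* The exponents are truncated subtractions: [b - i] is always exact, and      *)
(* [a - i] is exact for [b <= a]; for [a < b] the factor [i = a] is 0.         *)
Definition gauss_binomial (R : realType) (q a b : nat) : R :=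
  \prod_(i < b) ((q%:R ^+ (a - i) - 1) / (q%:R ^+ (b - i) - 1)).

Definition omega (R : realType) (q e : nat) : R :=
  \prod_(1 <= i < e.+1) (1 - q%:R ^- i).

(* Main.v *)
Require Import Defs.
From mathcomp Require Import all_boot all_order all_algebra.
From mathcomp Require Import finfield ring lra zify.
From mathcomp Require Import reals exp.

Set Implicit Arguments.
Unset Strict Implicit.
Unset Printing Implicit Defensive.

Import Order.TTheory GRing.Theory Num.Theory.
Local Open Scope ring_scope.

(** Join an [e1]-space to an [e2]-space, [e1 + e2 = d], when they meet
    trivially.  This bipartite graph is biregular of degree [q ^ (e1 * e2)], and
    its two sides have the same cardinal, the Gaussian binomial.  The first
    bound is the expander mixing lemma for this graph
    ([expander_mixing]): what has to be known is that its second singular value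
    is at most [q ^ (e1 * e2 - d / 2)] ([disj_contraction]).

    The spectrum comes from Delsarte's harmonic functions.  A function [g] on
    [j]-spaces is harmonic when its sum over the [j]-spaces through any given
    [(j-1)]-space vanishes.  It extends to [e]-spaces by summing over the
    [j]-subspaces ([incl]).  Three facts give the singular values.
    - Summing over [e2]-spaces disjoint from [Z] the extension of [g] multiplies
      by a constant the sum of [g] over the [j]-spaces disjoint from [Z]
      ([disj_incl]).
    - For harmonic [g] the sum over the [j]-spaces disjoint from [Z] is
      [kappa j] times the sum over those inside [Z] ([disj_harmonic]): harmonicity
      links the sums over the [j]-spaces that meet [Z] in dimension [k] and
      [k + 1], and one descends from [k = j] to [k = 0].
    - Every function on [e2]-spaces is a sum of extensions of harmonic functions
      of degrees [j <= e2] ([harmonic_decomposition]), because a function on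
      [j]-spaces is a harmonic one plus the extension of one on
      [(j-1)]-spaces: harmonicity is orthogonality to such extensions.
    So the adjacency operator followed by its transpose acts on the extensions of
    harmonic functions of degree [j] by a scalar, [eigen e1 e2 j].  Applying the
    first two facts in both directions yields this scalar with no need of the
    norms of extensions.  These scalars are
    [q ^ (2 * e1 * e2 - j * (d + 1 - j))]; they strictly decrease in
    [j <= e2], so the components of different degrees are orthogonal, and
    [eigen e1 e2 1] is the largest eigenvalue on functions of sum zero.

    The second bound follows since the degree divided by the number of vertices
    on a side strictly exceeds [omega R q e2] ([omega_gauss_lt]) and
    [sqrt ((1 / a1 - 1) * (1 / a2 - 1)) <= 1 / a - 1] for [a <= a1], [a <= a2];
    only when the lower bound vanishes does strictness have to come from the
    latter inequality. *)

(** * Double counting and q-integers *)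

Lemma double_count (I J : finType) (P : pred I) (Q : pred J)
    (r : I -> J -> bool) (a b : nat) :
    (forall x, P x -> #|[pred y | Q y && r x y]| = a) ->
    (forall y, Q y -> #|[pred x | P x && r x y]| = b) ->
  (#|P| * a = #|Q| * b)%N.
Proof.
move=> Pa Qb.
have -> : (#|P| * a = \sum_(x | P x) \sum_(y | Q y && r x y) 1)%N.
  by rewrite -sum_nat_const; apply: eq_bigr => x Px; rewrite -(Pa x Px) sum1_card.
rewrite (exchange_big_dep Q) /=; last by move=> x y _ /andP[].
rewrite -sum_nat_const; apply: eq_bigr => y Qy; rewrite -(Qb y Qy) -sum1_card.
by apply: eq_bigl => x; rewrite !inE Qy.
Qed.

Definition qnum (q n : nat) : nat := \sum_(i < n) q ^ i.

Lemma qnumS q n : qnum q n.+1 = (qnum q n + q ^ n)%N.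
Proof. by rewrite /qnum big_ord_recr. Qed.

Lemma qnum0 q : qnum q 0 = 0%N.
Proof. by rewrite /qnum big_ord0. Qed.

Lemma qnum1 q : qnum q 1 = 1%N.
Proof. by rewrite qnumS qnum0. Qed.

Lemma qnumD q m n : qnum q (m + n) = (qnum q m + q ^ m * qnum q n)%N.
Proof.
rewrite /qnum big_split_ord big_distrr /=; congr addn.
by apply: eq_bigr => i _; rewrite expnD.
Qed.

Lemma qnum_gt0 q n : (0 < n)%N -> (0 < qnum q n)%N.
Proof. by case: n => // n _; rewrite /qnum big_ord_recl addn_gt0. Qed.

Lemma qnum_exp q n : (0 < q)%N -> ((q - 1) * qnum q n + 1 = q ^ n)%N.
Proof.
move=> q0; elim: n => [|n IH]; first by rewrite qnum0 muln0.
by rewrite qnumS mulnDr addnAC IH expnS mulnBl mul1n subnKC // leq_pmull.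
Qed.

(** * Counting subspaces *)

Section Counting.

Variables (F : finFieldType) (d : nat).
Notation V := 'rV[F]_d.
Notation q := #|F|.
Implicit Types (S T U W Z : {vspace V}) (v : V).

Lemma card_field_gt1 : (1 < q)%N.
Proof. exact: finNzRing_gt1. Qed.

Lemma card_field_gt0 : (0 < q)%N.
Proof. exact: ltnW card_field_gt1. Qed.

Lemma dim_rV : \dim {:V} = d.
Proof. by rewrite dimvf /dim /= mul1n. Qed.

(** So the covers of [W] in the subspace order are the spaces [W + <[v]>] for [v]
    outside [W]. *)
Lemma dim_addv_line W v : \dim (W + <[v]>) = (\dim W + (v \notin W))%N.
Proof.
have [vW|vW] := boolP (v \in W).
  by rewrite (addv_idPl _) ?addn0 // -memvE.
rewrite dimv_disjoint_sum; last first.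
  apply/eqP; rewrite -subv0; apply/subvP => x /memv_capP[xW /vlineP[k xk]].
  have [k0|k0] := eqVneq k 0; first by rewrite xk k0 scale0r mem0v.
  case/negP: vW; rewrite -[v]scale1r -(mulVf k0) -scalerA -xk.
  exact: memvZ.
congr addn; rewrite dim_vline.
by apply/eqP; rewrite eqb1; apply: contraNneq vW => ->; rewrite mem0v.
Qed.

Lemma capv_eq0_dim S Z :
  ((S :&: Z)%VS == 0%VS) = (\dim (S + Z) == \dim S + \dim Z)%N.
Proof.
by rewrite -dimv_eq0 -(dimv_sum_cap S Z) -{1}[\dim (S + Z)]addn0 eqn_add2l eq_sym.
Qed.

Lemma card_vspace_diff U W : (W <= U)%VS ->
  (#|[pred v | (v \in U) && (v \notin W)]| + q ^ \dim W = q ^ \dim U)%N.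
Proof.
move=> WU; rewrite -(card_vspace U) -(card_vspace W) -(cardID (mem W) (mem U)).
rewrite addnC; congr addn; last by apply: eq_card => v; rewrite !inE andbC.
apply: eq_card => v; rewrite !inE /=.
by rewrite andbC; case: (boolP (v \in W)) => //= /(subvP WU) ->.
Qed.

Definition covered_by W S := (\dim S == (\dim W).+1) && (W <= S)%VS.

(** Choosing a vector [v] outside [W] chooses the cover [W + <[v]>], and each
    cover arises from the [q ^ (w + 1) - q ^ w] vectors that it has outside
    [W]. *)
Lemma card_covers_mul W (P : pred {vspace V}) :
  (#|[pred S | covered_by W S && P S]| * (q ^ \dim W * (q - 1))
   = #|[pred v | (v \notin W) && P (W + <[v]>)%VS]|)%N.
Proof.
rewrite -[RHS]sum1_card.
rewrite (partition_big (fun v => (W + <[v]>)%VS) [pred S | covered_by W S && P S]) /=;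
  last first.
  by move=> v /andP[vW ->]; rewrite andbT /covered_by dim_addv_line vW addn1 eqxx addvSl.
rewrite -sum1_card big_distrl /=; apply: eq_bigr => S /andP[/andP[/eqP dS WS] PS].
rewrite mul1n sum1_card.
have := card_vspace_diff WS; rewrite dS => h.
suff -> : #|[pred v | (v \notin W) && P (W + <[v]>)%VS & (W + <[v]>)%VS == S]|
   = #|[pred v | (v \in S) && (v \notin W)]|.
  by apply/eqP; rewrite -(eqn_add2r (q ^ \dim W)) h expnSr addnC -mulnS
    subn1 prednK // card_field_gt0.
apply: eq_card => v; rewrite !inE.
have [vW|vW] /= := boolP (v \in W); first by rewrite andbF.
rewrite andbT; have [vS|vS] := boolP (v \in S).
  suff -> : (W + <[v]>)%VS = S by rewrite PS eqxx.
  apply/eqP; rewrite eqEdim subv_add WS -memvE vS dim_addv_line vW dS addn1.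
  by rewrite leqnn.
apply/negbTE; apply: contra vS => /andP[_ /eqP <-].
by rewrite memvE addvSr.
Qed.

Lemma card_covers_within W U : (W <= U)%VS ->
  #|[pred S | covered_by W S && (S <= U)%VS]| = qnum q (\dim U - \dim W).
Proof.
move=> WU; have := card_covers_mul W (fun S => (S <= U)%VS).
rewrite (eq_card (B := [pred v | (v \in U) && (v \notin W)])); last first.
  by move=> v; rewrite !inE subv_add WU -memvE andbC.
have := card_vspace_diff WU.
have dWU := dimvS WU.
rewrite -{1}(subnKC dWU) expnD -(qnum_exp (\dim U - \dim W) card_field_gt0).
have q1 := card_field_gt1.
have : (0 < q ^ \dim W * (q - 1))%N by rewrite muln_gt0 expn_gt0 subn_gt0 q1 ltnW.
move=> c0 h1 h2; apply/eqP; rewrite -(eqn_pmul2r c0) h2.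
rewrite -(eqn_add2r (q ^ \dim W)) h1; apply/eqP; ring.
Qed.

(** If [W] meets [Z] trivially, then so does [W + <[v]>] exactly when [v] lies
    outside [W + Z]. *)
Lemma card_covers_avoiding W Z : (W :&: Z = 0)%VS ->
  #|[pred S | covered_by W S && ((S :&: Z)%VS == 0%VS)]|
  = (q ^ \dim Z * qnum q (d - (\dim W + \dim Z)))%N.
Proof.
move=> WZ; have dWZ := dimv_disjoint_sum WZ.
have := card_covers_mul W (fun S => (S :&: Z)%VS == 0%VS).
rewrite (eq_card (B := [pred v | (v \in fullv) && (v \notin (W + Z)%VS)])); last first.
  move=> v; rewrite !inE memvf capv_eq0_dim -addvA (addvC <[v]>%VS) addvA !dim_addv_line dWZ.
  have [vW|vW] /= := boolP (v \in W).
    by rewrite (subvP (addvSl W Z)).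
  case: (v \notin _); first by rewrite addnAC eqxx.
  by rewrite addnAC addn1 addn0 ltn_eqF.
have := card_vspace_diff (subvf (W + Z)).
have dle : (\dim W + \dim Z <= d)%N.
  by rewrite -dWZ; have := dimvS (subvf (W + Z)); rewrite dim_rV.
have e : (q ^ d = q ^ (\dim W + \dim Z) * q ^ (d - (\dim W + \dim Z)))%N.
  by rewrite -expnD subnKC.
rewrite dim_rV dWZ e -(qnum_exp (d - _) card_field_gt0).
have q1 := card_field_gt1.
have : (0 < q ^ \dim W * (q - 1))%N by rewrite muln_gt0 expn_gt0 subn_gt0 q1 ltnW.
move=> c0 h1 h2; apply/eqP; rewrite -(eqn_pmul2r c0) h2.
rewrite -(eqn_add2r (q ^ (\dim W + \dim Z))) h1 expnD; apply/eqP; ring.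
Qed.

(** Double counting of the pairs made of a hyperplane [W] of [T] and a cover
    [S] of [P] with [P <= S <= W] reduces the claim from [P] to [S], one
    dimension up; this avoids duality. *)
Lemma card_hyperplanes n P T : (P <= T)%VS -> \dim T = (\dim P + n)%N ->
  #|[pred W | covered_by W T && (P <= W)%VS]| = qnum q n.
Proof.
case: n => [|n] PT dT.
  rewrite qnum0; apply: eq_card0 => W; rewrite !inE; apply/negbTE/negP.
  by case/andP=> /andP[/eqP dW WT] /dimvS; rewrite -ltnS -dW dT addn0 ltnn.
elim: n P PT dT => [|n IH] P PT dT.
  rewrite qnum1; transitivity #|pred1 P|; last exact: card1.
  apply: eq_card => W; rewrite !inE /covered_by.
  rewrite dT addn1 eqSS; apply/idP/eqP => [|->]; last by rewrite eqxx PT subvv.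
  case/andP=> /andP[/eqP dW WT] PW; apply/eqP.
  by rewrite eq_sym eqEdim PW dW leqnn.
have := @double_count _ _ [pred W | covered_by W T && (P <= W)%VS]
  [pred S | covered_by P S && (S <= T)%VS] (fun W S => (S <= W)%VS)
  (qnum q n.+1) (qnum q n.+1).
rewrite card_covers_within // dT addKn => H.
apply/eqP; rewrite -(eqn_pmul2r (@qnum_gt0 q n.+1 isT)); apply/eqP/H.
- move=> W /= /andP[/andP[/eqP dW WT] PW].
  have -> : n.+1 = (\dim W - \dim P)%N by rewrite dT in dW; lia.
  rewrite -(card_covers_within PW); apply: eq_card => S; rewrite !inE -!andbA.
  by case: (boolP (S <= W)%VS) => [/subv_trans->|_]; rewrite ?andbT ?andbF.
- move=> S /= /andP[/andP[/eqP dS PS] ST].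
  rewrite -(IH _ ST); last by rewrite dT dS addnS.
  apply: eq_card => W; rewrite !inE -!andbA.
  by case: (boolP (S <= W)%VS) => [/(subv_trans PS)->|_]; rewrite ?andbT ?andbF.
Qed.

(** Induction as for [card_hyperplanes]: count the pairs of a complement [S] of
    [Z] through [T] and a cover of [T] inside [S]; such a cover meets [Z]
    trivially because [S] does. *)
Lemma card_complements n T Z : (T :&: Z = 0)%VS -> (\dim T + n + \dim Z)%N = d ->
  #|[pred S | [&& \dim S == (\dim T + n)%N, (T <= S)%VS & (S :&: Z)%VS == 0%VS]]|
  = (q ^ (\dim Z * n))%N.
Proof.
elim: n T => [|n IH] T TZ dTZ.
  rewrite muln0 expn0; transitivity #|pred1 T|; last exact: card1.
  apply: eq_card => S; rewrite !inE addn0.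
  apply/idP/eqP => [|->]; last by rewrite eqxx subvv TZ eqxx.
  by case/and3P=> /eqP dS TS _; apply/eqP; rewrite eq_sym eqEdim TS dS leqnn.
have := @double_count _ _
  [pred S | [&& \dim S == (\dim T + n.+1)%N, (T <= S)%VS & (S :&: Z)%VS == 0%VS]]
  [pred S | covered_by T S && ((S :&: Z)%VS == 0%VS)]
  (fun S T' => (T' <= S)%VS) (qnum q n.+1) (q ^ (\dim Z * n))%N.
rewrite card_covers_avoiding // => H.
apply/eqP; rewrite -(eqn_pmul2r (@qnum_gt0 q n.+1 isT)); apply/eqP.
rewrite H.
- have -> : (d - (\dim T + \dim Z) = n.+1)%N by lia.
  rewrite mulnS expnD; ring.
- move=> S /= /and3P[/eqP dS TS /eqP SZ].
  have -> : n.+1 = (\dim S - \dim T)%N by lia.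
  rewrite -(card_covers_within TS); apply: eq_card => T'; rewrite !inE -!andbA.
  case: (boolP (T' <= S)%VS) => [T'S|_]; rewrite ?andbT ?andbF //.
  suff -> : ((T' :&: Z)%VS == 0%VS) by rewrite !andbT.
  by rewrite -subv0 -SZ capvS.
- move=> T' /= /andP[/andP[/eqP dT' TT'] /eqP T'Z].
  rewrite -(IH _ T'Z); last by rewrite dT' addSnnS.
  apply: eq_card => S; rewrite !inE dT' addSnnS -!andbA.
  by case: (boolP (T' <= S)%VS) => [/(subv_trans TT')->|_]; rewrite ?andbT ?andbF.
Qed.

(** Count the incident pairs in dimensions [k] and [k + 1]. *)
Lemma card_subspacesS k :
  (#|subspaces F d k.+1| * qnum q k.+1 = #|subspaces F d k| * qnum q (d - k))%N.
Proof.
apply: (@double_count _ _ [in subspaces F d k.+1] [in subspaces F d k]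
  (fun S W => (W <= S)%VS)) => S /=; rewrite inE => /eqP dS.
  have := card_hyperplanes (sub0v S) (n := k.+1); rewrite dimv0 dS => <- //.
  by apply: eq_card => W; rewrite !inE /covered_by sub0v andbT dS eqSS eq_sym.
have := card_covers_within (subvf S); rewrite dim_rV dS => <-.
by apply: eq_card => W; rewrite !inE /covered_by subvf andbT dS.
Qed.

End Counting.

(** * Solvability of the normal equations *)

(** The diagonal entries of [A *m A^T] are sums of squares. *)
Lemma mulmx_tr_self_eq0 (R : realFieldType) m n (A : 'M[R]_(m, n)) :
  A *m A^T = 0 -> A = 0.
Proof.
move=> A0; apply/matrixP => i j; rewrite mxE.
move/matrixP/(_ i i): A0; rewrite !mxE => /eqP.
rewrite psumr_eq0 => [|k _]; last by rewrite mxE -expr2 sqr_ge0.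
by move/allP/(_ j (mem_index_enum _)); rewrite mxE mulf_eq0 orbb => /eqP.
Qed.

(** [U *m U^T] and [U] have the same kernel, hence the same rank, so the row
    space of [U *m U^T], which lies in that of [U^T], is all of it. *)
Lemma normal_equations_mx (R : realFieldType) m n p (U : 'M[R]_(m, n))
    (h : 'M[R]_(p, n)) : exists x : 'M[R]_(p, m), x *m U *m U^T = h *m U^T.
Proof.
have kerU : (kermx (U *m U^T) <= kermx U)%MS.
  apply/sub_kermxP/mulmx_tr_self_eq0.
  by rewrite trmx_mul mulmxA -[kermx _ *m U *m _]mulmxA mulmx_ker mul0mx.
have rkU : (\rank U^T <= \rank (U *m U^T))%N.
  have := mxrankS kerU; rewrite !mxrank_ker mxrank_tr.
  by have := rank_leq_row U; have := rank_leq_row (U *m U^T); lia.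
have sUUt : (U^T <= U *m U^T)%MS.
  by have [_ <-] := mxrank_leqif_sup (submxMl U U^T); rewrite eqn_leq rkU
    mxrankS ?submxMl.
have [x xE] := submxP (submx_trans (submxMl h U^T) sUUt).
by exists x; rewrite xE mulmxA.
Qed.

(** The orthogonal projection of [h] on the span of the family [u] exists:
    [h'] gives its coefficients. *)
Lemma normal_equations (R : realFieldType) (I J : finType) (u : I -> J -> R)
    (h : J -> R) : exists h' : I -> R, forall i,
  \sum_j u i j * (h j - \sum_k u k j * h' k) = 0.
Proof.
pose U := \matrix_(a < #|I|, b < #|J|) u (enum_val a) (enum_val b).
have [x xE] := normal_equations_mx U (\row_b h (enum_val b)).
exists (fun i => x 0 (enum_rank i)) => i.
transitivity ((((\row_b h (enum_val b)) - x *m U) *m U^T) 0 (enum_rank i)).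
  rewrite mxE (reindex (@enum_val J predT)); last first.
    exact: onW_bij (enum_val_bij _).
  apply: eq_bigr => b _; rewrite !mxE enum_rankK mulrC; congr ((_ - _) * _).
  rewrite (reindex (@enum_val I predT)); last exact: onW_bij (enum_val_bij _).
  by apply: eq_bigr => a _; rewrite !mxE enum_valK mulrC.
by rewrite mulmxBl xE subrr mxE.
Qed.

(** * Inclusion, disjointness and harmonic functions *)

Section Operators.

Variables (R : realType) (F : finFieldType) (d : nat).
Notation V := 'rV[F]_d.
Notation q := #|F|.
Implicit Types (S T U W Z : {vspace V}) (f g h : {vspace V} -> R) (i j k e : nat).

(** The two transforms are meant for functions on [j]-spaces; the values of
    [g] in other dimensions are ignored. *)
Definition incl j g S : R := \sum_(T | (\dim T == j) && (T <= S)%VS) g T.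

Definition disj j g Z : R :=
  \sum_(T | (\dim T == j) && ((T :&: Z)%VS == 0%VS)) g T.

(** [(\dim W).+1 = j] rather than [\dim W = j.-1], so that every function is
    harmonic of degree 0. *)
Definition harmonic j g :=
  forall W, (\dim W).+1 = j -> \sum_(T | covered_by W T) g T = 0.

(** Up to sign, [q ^ (j * (j - 1) / 2)]. *)
Definition kappa j : R := \prod_(i < j) (- q%:R ^+ i).

Lemma sum_const_card (I : finType) (P : pred I) (x : R) n :
  #|P| = n -> \sum_(i | P i) x = n%:R * x.
Proof. by move=> <-; rewrite sumr_const mulr_natl. Qed.

(** A [k]-space [W <= S] lies in [qnum q (\dim S - k)] of the [(k+1)]-spaces
    inside [S]. *)
Lemma incl_incl k h S :
  incl k.+1 (incl k h) S = (qnum q (\dim S - k))%:R * incl k h S.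
Proof.
rewrite /incl (exchange_big_dep (fun W => (\dim W == k) && (W <= S)%VS)) /=.
  rewrite big_distrr; apply: eq_bigr => W /= /andP[/eqP dW WS]; apply: sum_const_card.
  rewrite -dW -card_covers_within //; apply: eq_card => T.
  rewrite !inE unfold_in /= /covered_by dW eqxx /=.
  by rewrite -!andbA [(W <= T)%VS && _]andbC.
by move=> T W /andP[_ TS] /andP[-> WT]; apply: subv_trans TS.
Qed.

(** The number of [e]-spaces through [T] disjoint from [Z] depends only on
    whether [T] itself is disjoint from [Z]: [e] and [\dim Z] being
    complementary, these spaces are complements of [Z]. *)
Lemma disj_incl j e g Z : (j <= e)%N -> (e + \dim Z)%N = d ->
  disj e (incl j g) Z = q%:R ^+ (\dim Z * (e - j)) * disj j g Z.
Proof.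
move=> je eZ; rewrite /incl /disj.
rewrite (exchange_big_dep (fun T => (\dim T == j) && ((T :&: Z)%VS == 0%VS))) /=.
  rewrite big_distrr; apply: eq_bigr => T /= /andP[/eqP dT /eqP TZ].
  rewrite -natrX; apply: sum_const_card.
  rewrite -(card_complements (n := e - j) TZ) ?dT ?subnKC //.
  apply: eq_card => S; rewrite !inE unfold_in /=.
  rewrite eqxx /=.
  by rewrite -andbA [(_ == 0%VS) && _]andbC.
move=> S T /andP[_ /eqP SZ] /andP[-> TS] /=.
by rewrite -subv0 -SZ capvS.
Qed.

(** The levels interpolate between the two transforms: level 0 is [disj] and
    level [j] is [incl]. *)
Definition level j g Z k : R :=
  \sum_(T | (\dim T == j) && (\dim (T :&: Z) == k)) g T.

Lemma disj_level j g Z : disj j g Z = level j g Z 0.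
Proof. by apply: eq_bigl => T; rewrite dimv_eq0. Qed.

Lemma incl_level j g Z : incl j g Z = level j g Z j.
Proof.
apply: eq_bigl => T; case: eqP => //= <-.
by rewrite (dimv_leqif_eq (capvSl T Z)); apply/capv_idPl/eqP.
Qed.

(** A hyperplane [W] of [T] meets [Z] in the same dimension as [T] if it
    contains [T :&: Z], and in one dimension less otherwise. *)
Lemma card_hyperplanes_meet T Z k : (k <= \dim T)%N ->
  #|[pred W | covered_by W T && (\dim (W :&: Z) == k)]| =
    (if \dim (T :&: Z) == k then qnum q (\dim T - k)
     else if \dim (T :&: Z) == k.+1 then q ^ (\dim T - k.+1) * qnum q k.+1
     else 0)%N.
Proof.
move=> kT; set P := (T :&: Z)%VS; set m := \dim P.
have PT : (P <= T)%VS := capvSl _ _.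
have mT : (m <= \dim T)%N := dimvS PT.
have meetP W : covered_by W T -> (W :&: Z)%VS = (W :&: P)%VS.
  by case/andP=> _ WT; rewrite /P capvA (capv_idPl WT).
(* A hyperplane of T meets the subspace P of T in codimension at most 1. *)
have meet_dim W : covered_by W T -> \dim (W :&: Z) = (m - ~~ (P <= W)%VS)%N.
  move=> cW; rewrite (meetP _ cW); case: (boolP (P <= W)%VS) => PW /=.
    by rewrite (capv_idPr PW) subn0.
  case/andP: cW => /eqP dW WT.
  have := dimv_sum_cap W P; rewrite -/m.
  have : (\dim (W + P) <= (\dim W).+1)%N by rewrite -dW dimvS // subv_add WT PT.
  have : (\dim (W :&: P) < m)%N.
    rewrite ltn_neqAle dimvS ?capvSr // andbT (dimv_leqif_eq (capvSr W P)).
    by apply: contra PW => /eqP/capv_idPr.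
  lia.
have card_above : #|[pred W | covered_by W T && (P <= W)%VS]| = qnum q (\dim T - m).
  by apply: card_hyperplanes; rewrite ?subnKC.
have card_all : #|[pred W | covered_by W T]| = qnum q (\dim T).
  have := card_hyperplanes (sub0v T) (n := \dim T); rewrite dimv0 => <- //.
  by apply: eq_card => W; rewrite !inE sub0v andbT.
case: eqP => [mk|mk].
  rewrite -mk -card_above; apply: eq_card => W; rewrite !inE.
  case cW: (covered_by W T) => //=; rewrite (meet_dim _ cW).
  case: (boolP (P <= W)%VS) => PW /=; rewrite ?subn0 ?eqxx //.
  have m0 : (0 < m)%N.
    by rewrite lt0n dimv_eq0; apply: contra PW => /eqP->; rewrite sub0v.
  by apply/negbTE; rewrite subn1; lia.
case: eqP => [mk1|mk1]; last first.
  apply: eq_card0 => W; rewrite !inE.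
  case cW: (covered_by W T) => //=; rewrite (meet_dim _ cW).
  by case: (P <= W)%VS => /=; apply/negbTE; lia.
apply/eqP; rewrite -(eqn_add2l (qnum q (\dim T - k.+1))); apply/eqP.
have -> : (qnum q (\dim T - k.+1) + q ^ (\dim T - k.+1) * qnum q k.+1
           = qnum q (\dim T))%N.
  have kT' : (k.+1 <= \dim T)%N by rewrite -mk1.
  by rewrite -qnumD subnK.
rewrite -{1}mk1 -card_above -card_all.
(* The remaining case: complement of the hyperplanes that contain P. *)
rewrite -(cardID (fun W => (P <= W)%VS) [pred W | covered_by W T]).
congr addn; apply: eq_card => W; rewrite !inE.
rewrite unfold_in /=.
case cW: (covered_by W T) => /=; rewrite ?andbF // andbT (meet_dim _ cW).
by case: (P <= W)%VS => /=; lia.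
Qed.

(** Sum the harmonicity relations of [g] over all [W] of dimension [j - 1] that
    meet [Z] in dimension [k], and collect the coefficient of each [g T]. *)
Lemma level_rec j g Z k : harmonic j g -> (k < j)%N ->
  level j g Z k * (qnum q (j - k))%:R =
    - (q%:R ^+ (j - k.+1) * (qnum q k.+1)%:R) * level j g Z k.+1.
Proof.
move=> gH kj; apply/eqP; rewrite mulNr -subr_eq0 opprK; apply/eqP.
transitivity (\sum_(W | ((\dim W).+1 == j) && (\dim (W :&: Z) == k))
                \sum_(T | covered_by W T) g T); last first.
  by apply: big1 => W /andP[/eqP dW _]; apply: gH.
rewrite (exchange_big_dep (fun T => \dim T == j)) /=; last first.
  by move=> W T /andP[/eqP<- _] /andP[].
pose c T := #|[pred W | covered_by W T && (\dim (W :&: Z) == k)]|.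
transitivity (\sum_(T | \dim T == j) (c T)%:R * g T); last first.
  apply: eq_bigr => T /eqP dT; rewrite (@sum_const_card _ _ _ (c T)) //.
  apply: eq_card => W; rewrite !inE unfold_in /= /covered_by dT.
  by rewrite [j == _]eq_sym; do !case: (_ == _); rewrite ?andbT ?andbF.
rewrite /level [X in X * _]big_mkcondr [X in _ + _ * X]big_mkcondr /=.
rewrite mulr_suml mulr_sumr -big_split /=; apply: eq_bigr => T /eqP dT.
rewrite /c card_hyperplanes_meet dT ?(ltnW kj) //.
case: eqP => [->|_]; first by rewrite ltn_eqF // mulr0 addr0 mulrC.
case: eqP => [_|_]; last by rewrite mul0r mulr0 mul0r addr0.
by rewrite mul0r add0r natrM natrX.
Qed.

(** Chaining [level_rec] from [k = 0] to [k = j], the q-factorials on both sides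
    are the same product in opposite orders and cancel. *)
Lemma disj_harmonic j g Z : harmonic j g -> disj j g Z = kappa j * incl j g Z.
Proof.
move=> gH; rewrite disj_level incl_level.
have qn0 n : (qnum q n.+1)%:R != 0 :> R by rewrite pnatr_eq0 -lt0n qnum_gt0.
have H k : (k <= j)%N -> level j g Z 0 * \prod_(i < k) (qnum q (j - i))%:R =
    \prod_(i < k) (- (q%:R ^+ (j - i.+1) * (qnum q i.+1)%:R)) * level j g Z k.
  elim: k => [|k IH] kj; first by rewrite !big_ord0 mulr1 mul1r.
  rewrite !big_ord_recr /= mulrA IH ?(ltnW kj) // -!mulrA; congr (_ * _).
  by rewrite level_rec.
have p0 : \prod_(i < j) (qnum q i.+1)%:R != 0 :> R.
  by apply/prodf_neq0 => i _.
apply: (mulIf p0); have := H _ (leqnn j).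
rewrite -[in X in X = _ -> _](big_mkord xpredT (fun i => (qnum q (j - i))%:R)).
rewrite big_nat_rev big_mkord add0n.
under eq_bigr => i _ do rewrite subKn ?ltn_ord //.
move=> ->.
rewrite /kappa mulrAC -big_split /=; congr (_ * _).
under eq_bigr => i _ do rewrite -mulNr.
rewrite !big_split /=; congr (_ * _).
rewrite -[LHS](big_mkord xpredT (fun i => - q%:R ^+ (j - i.+1))) big_nat_rev big_mkord.
by apply: eq_bigr => i _; rewrite add0n subnSK // subKn // ltnW.
Qed.

End Operators.

(** * The spectrum of the disjointness operator *)

Section Spectrum.

Variables (R : realType) (F : finFieldType) (d : nat).
Notation V := 'rV[F]_d.
Notation q := #|F|.
Implicit Types (S T U W Z : {vspace V}) (f g h : {vspace V} -> R) (i j k e : nat).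

Lemma q_gt0 : 0 < q%:R :> R.
Proof. by rewrite ltr0n card_field_gt0. Qed.

Lemma q_gt1 : 1 < q%:R :> R.
Proof. by rewrite ltr1n card_field_gt1. Qed.

(** Harmonic functions on [(k+1)]-spaces are the orthogonal complement of the
    extensions of functions on [k]-spaces: [incl k h'] is the orthogonal
    projection of [h]. *)
Lemma harmonic_split k h : exists h',
  harmonic k.+1 (fun T => h T - incl k h' T).
Proof.
have [h' hE] := normal_equations (fun W T : {vspace V} =>
  ((\dim T == k.+1) && ((\dim W == k) && (W <= T)%VS))%:R : R) h.
exists h' => W [dW]; rewrite -[RHS](hE W) big_mkcond; apply: eq_bigr => T _.
rewrite dW eqxx /covered_by dW; case: (\dim T =P k.+1) => dT /=; last by rewrite mul0r.
case: (W <= T)%VS; last by rewrite mul0r.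
rewrite mul1r; congr (_ - _); rewrite /incl big_mkcond; apply: eq_bigr => U _.
by case: (_ && _); rewrite ?mul1r ?mul0r.
Qed.

Lemma incl_scale k c h S : incl k (fun T => c * h T) S = c * incl k h S.
Proof. by rewrite /incl mulr_sumr. Qed.

(** Split off the harmonic part of [h] and extend the rest,
    [incl j h'], to [e]-spaces in one step instead of two: by [incl_incl] this
    only costs a scalar, which is absorbed in [h']. *)
Lemma harmonic_decomposition e h j : (j <= e)%N ->
  exists g : nat -> {vspace V} -> R, (forall i, (i <= j)%N -> harmonic i (g i)) /\
    forall S, \dim S = e -> incl j h S = \sum_(i < j.+1) incl i (g i) S.
Proof.
elim: j h => [|j IH] h je.
  exists (fun=> h); split=> [i|S _]; last by rewrite big_ord_recl big_ord0 addr0.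
  by rewrite leqn0 => /eqP-> W.
have [h' hH] := harmonic_split j h.
have [g [gH gE]] := IH (fun T => (qnum q (e - j))%:R * h' T) (ltnW je).
exists (fun i => if i == j.+1 then fun T => h T - incl j h' T else g i); split.
  by move=> i; rewrite leq_eqVlt; case: eqP => [-> _ //|_ /= ij]; apply: gH.
move=> S dS; rewrite big_ord_recr /= eqxx.
under eq_bigr => i _ do rewrite ltn_eqF //.
rewrite -gE // incl_scale -dS -incl_incl -big_split /=.
by apply: eq_bigr => T _; rewrite addrC subrK.
Qed.

Lemma disj_adjoint e1 e2 f h :
  \sum_(Z | \dim Z == e1) disj e2 f Z * h Z =
  \sum_(S | \dim S == e2) f S * disj e1 h S.
Proof.
under eq_bigr => Z _ do rewrite mulr_suml.
rewrite (exchange_big_dep (fun S => \dim S == e2)) /=; last by move=> Z S _ /andP[].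
apply: eq_bigr => S dS; rewrite mulr_sumr; apply: eq_bigl => Z.
by rewrite dS capvC.
Qed.

(** Left unsimplified as the product of the scalars met when passing from
    [e2]-spaces to [e1]-spaces and back. *)
Definition eigen e1 e2 j : R :=
  q%:R ^+ (e1 * (e2 - j)) * kappa R F j * (q%:R ^+ (e2 * (e1 - j)) * kappa R F j).

Lemma disj_disj_harmonic e1 e2 j g S : (e1 + e2)%N = d -> (j <= e1)%N -> (j <= e2)%N ->
  harmonic j g -> \dim S = e2 ->
  disj e1 (disj e2 (incl j g)) S = eigen e1 e2 j * incl j g S.
Proof.
move=> e12 j1 j2 gH dS.
transitivity (q%:R ^+ (e1 * (e2 - j)) * kappa R F j * disj e1 (incl j g) S).
  rewrite /disj mulr_sumr; apply: eq_bigr => Z /andP[/eqP dZ _].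
  rewrite -[LHS]/(disj e2 (incl j g) Z) disj_incl ?dZ //; last by rewrite addnC.
  by rewrite disj_harmonic // mulrA.
by rewrite disj_incl ?dS // disj_harmonic // -!mulrA.
Qed.

Lemma kappa_sqrS j : kappa R F j.+1 ^+ 2 = kappa R F j ^+ 2 * q%:R ^+ (2 * j).
Proof. by rewrite /kappa big_ord_recr exprMn sqrrN -exprM mulnC. Qed.

Lemma kappa_neq0 j : kappa R F j != 0.
Proof.
by apply/prodf_neq0 => i _; rewrite oppr_eq0 expf_neq0 // lt0r_neq0 // q_gt0.
Qed.

Lemma kappa_sqr_gt0 j : 0 < kappa R F j ^+ 2.
Proof. by rewrite exprn_even_gt0 //= kappa_neq0. Qed.

Lemma eigenE e1 e2 j :
  eigen e1 e2 j = q%:R ^+ (e1 * (e2 - j) + e2 * (e1 - j)) * kappa R F j ^+ 2.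
Proof. by rewrite /eigen exprD; ring. Qed.

(** The right side divided by the left one is [q ^ (e1 + e2 - 2 * j)], whose exponent is
    positive because [2 * j < e1 + e2]. *)
Lemma eigen_lt e1 e2 j : (j.+1 <= e2)%N -> (e2 <= e1)%N ->
  eigen e1 e2 j.+1 < eigen e1 e2 j.
Proof.
move=> j2 e21; rewrite !eigenE kappa_sqrS mulrCA [X in _ < X]mulrC.
rewrite ltr_pM2l ?kappa_sqr_gt0 //.
rewrite mulrC -exprD ltr_eXn2l ?q_gt1 //.
by nia.
Qed.

Lemma eigen_anti e1 e2 i j : (i < j)%N -> (j <= e2)%N -> (e2 <= e1)%N ->
  eigen e1 e2 j < eigen e1 e2 i.
Proof.
elim: j => // j IH; rewrite ltnS leq_eqVlt => /predU1P[->|ij] j2 e21.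
  exact: eigen_lt.
exact: lt_trans (eigen_lt j2 e21) (IH ij (ltnW j2) e21).
Qed.

(** So the square root of [eigen e1 e2 1], the second singular value of the
    disjointness graph, is [q ^ (e1 * e2 - (e1 + e2) / 2)]. *)
Lemma eigen_one e1 e2 : (1 <= e2)%N -> (e2 <= e1)%N ->
  eigen e1 e2 1 * q%:R ^+ (e1 + e2) = q%:R ^+ (e1 * e2) ^+ 2.
Proof.
move=> h1 h2; rewrite eigenE /kappa big_ord_recr big_ord0 /= mul1r sqrrN expr0.
rewrite expr1n mulr1 -exprD -exprM; congr (_ ^+ _); nia.
Qed.

(** The operator followed by its transpose has eigenvalue [eigen e1 e2 k] on
    the component of degree [k]; as this product is symmetric and its eigenvalues
    are distinct, the components are orthogonal.  The component of degree 0 is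
    constant, so it is killed by the hypothesis on the sum. *)
Lemma disj_contraction e1 e2 f : (e1 + e2)%N = d -> (e2 <= e1)%N ->
  \sum_(S | \dim S == e2) f S = 0 ->
  \sum_(Z | \dim Z == e1) disj e2 f Z ^+ 2
    <= eigen e1 e2 1 * \sum_(S | \dim S == e2) f S ^+ 2.
Proof.
move=> e12 h21 f0.
have [g [gH gE]] := harmonic_decomposition f (leqnn e2).
pose c i := incl i (g i).
pose dot (a b : {vspace V} -> R) : R := \sum_(S | \dim S == e2) a S * b S.
have fE S : \dim S = e2 -> f S = \sum_(i < e2.+1) c i S.
  move=> dS; rewrite -gE // /incl (big_pred1 S) // => T /=.
  apply/andP/eqP => [[/eqP dT TS]|->]; last by rewrite dS eqxx subvv.
  by apply/eqP; rewrite eqEdim TS dT dS leqnn.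
have eigc i S : (i <= e2)%N -> \dim S = e2 ->
    disj e1 (disj e2 (c i)) S = eigen e1 e2 i * c i S.
  by move=> ie dS; apply: disj_disj_harmonic => //; [apply: leq_trans ie _|apply: gH].
have dot_eig a i : (i <= e2)%N ->
    \sum_(Z | \dim Z == e1) disj e2 a Z * disj e2 (c i) Z = eigen e1 e2 i * dot a (c i).
  move=> ie; rewrite disj_adjoint mulr_sumr; apply: eq_bigr => S /eqP dS.
  by rewrite eigc // mulrCA.
have dotC a b : dot a b = dot b a by apply: eq_bigr => S _; rewrite mulrC.
have ortho i k : (i < k <= e2)%N -> dot (c i) (c k) = 0.
  case/andP=> ik ke; have ie := leq_trans (ltnW ik) ke.
  have := dot_eig (c i) k ke; under eq_bigr => Z _ do rewrite mulrC.
  rewrite (dot_eig _ _ ie) (dotC (c k)) => /eqP.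
  rewrite -subr_eq0 -mulrBl mulf_eq0 subr_eq0 => /orP[/eqP E|/eqP //].
  by have := eigen_anti ik ke h21; rewrite E ltxx.
have dotf k : (k <= e2)%N -> dot f (c k) = dot (c k) (c k).
  move=> ke; transitivity (\sum_(i < e2.+1) dot (c i) (c k)).
    rewrite exchange_big /=; apply: eq_bigr => S /eqP dS.
    by rewrite fE // mulr_suml.
  rewrite (bigD1 (Ordinal (n := e2.+1) (m := k) ke)) //= big1 ?addr0 // => i /eqP ik.
  have ie : (i <= e2)%N by rewrite -ltnS.
  have [lt|gt|E] := ltngtP i k; first by rewrite ortho ?lt.
    by rewrite dotC ortho ?gt.
  by case: ik; apply: val_inj.
have c0 : dot (c 0%N) (c 0%N) = 0.
  rewrite -dotf // /dot.
  under eq_bigr => S _.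
    rewrite [c 0%N S](_ : _ = g 0%N 0%VS); last first.
      rewrite /c /incl (big_pred1 0%VS) // => T /=.
      by rewrite dimv_eq0; case: eqP => [->|]; rewrite ?sub0v.
    over.
  by rewrite -mulr_suml f0 mul0r.
have -> : \sum_(Z | \dim Z == e1) disj e2 f Z ^+ 2 =
    \sum_(k < e2.+1) eigen e1 e2 k * dot (c k) (c k).
  transitivity (\sum_(k < e2.+1)
      \sum_(Z | \dim Z == e1) disj e2 f Z * disj e2 (c k) Z).
    rewrite exchange_big; apply: eq_bigr => Z _ /=; rewrite expr2 -mulr_sumr.
    congr (_ * _); rewrite /disj [RHS]exchange_big; apply: eq_bigr => S /andP[/eqP dS _].
    by rewrite fE.
  by apply: eq_bigr => k _; rewrite dot_eig ?dotf // -ltnS.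
have -> : \sum_(S | \dim S == e2) f S ^+ 2 = \sum_(k < e2.+1) dot (c k) (c k).
  transitivity (\sum_(k < e2.+1) dot f (c k)).
    rewrite exchange_big; apply: eq_bigr => S /eqP dS /=.
    by rewrite -mulr_sumr -fE.
  by apply: eq_bigr => k _; rewrite dotf // -ltnS.
rewrite mulr_sumr; apply: ler_sum => k _.
case: (posnP k) => [->|k0]; first by rewrite c0 !mulr0.
rewrite ler_wpM2r //; first by apply: sumr_ge0 => S _; rewrite -expr2 sqr_ge0.
move: k0; rewrite leq_eqVlt => /predU1P[<-|k1]; first by rewrite lexx.
by rewrite ltW // eigen_anti // -ltnS.
Qed.

End Spectrum.

(** * Gaussian binomials *)

Section Gauss.

Variables (R : realType) (F : finFieldType) (d : nat).
Notation V := 'rV[F]_d.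
Notation q := #|F|.

Lemma qnumE n : q%:R ^+ n - 1 = (q%:R - 1) * (qnum q n)%:R :> R.
Proof.
rewrite -natrX -(qnum_exp n (card_field_gt0 F)) natrD natrM natrB ?card_field_gt0 //.
by rewrite addrK.
Qed.

Lemma qexp_gt1 n : (0 < n)%N -> 0 < q%:R ^+ n - 1 :> R.
Proof. by move=> n0; rewrite subr_gt0 exprn_egt1 ?q_gt1 // -lt0n. Qed.

Lemma card_subspaces0 : #|subspaces F d 0| = 1%N.
Proof.
transitivity #|[set (0%VS : {vspace V})]|; last exact: cards1.
by apply: eq_card => S; rewrite !inE dimv_eq0.
Qed.

(** Reversing the denominator makes it independent of [b] up to its length,
    as needed for an induction on [b]. *)
Lemma gauss_binomial_split a b : gauss_binomial R q a b =
  (\prod_(i < b) (q%:R ^+ (a - i) - 1)) / \prod_(i < b) (q%:R ^+ i.+1 - 1).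
Proof.
rewrite /gauss_binomial big_split /= prodfV; congr (_ / _).
rewrite -(big_mkord xpredT (fun i => q%:R ^+ (b - i) - 1)) big_nat_rev big_mkord.
by apply: eq_bigr => i _; rewrite add0n subKn.
Qed.

Lemma card_subspaces k : #|subspaces F d k|%:R = gauss_binomial R q d k.
Proof.
rewrite gauss_binomial_split; elim: k => [|k IH].
  by rewrite !big_ord0 divr1 card_subspaces0.
rewrite !big_ord_recr /= -mulf_div -IH !qnumE.
have q1 : q%:R - 1 != 0 :> R by rewrite subr_eq0 gt_eqF ?q_gt1.
rewrite -mulf_div divff // mul1r mulrA -natrM -card_subspacesS natrM mulfK //.
by rewrite pnatr_eq0 -lt0n qnum_gt0.
Qed.

Lemma omega_gt0 e : 0 < omega R q e.
Proof.
rewrite /omega big_add1 big_mkord; apply: prodr_gt0 => i _.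
by rewrite subr_gt0 invf_lt1 ?exprn_gt0 ?q_gt0 // exprn_egt1 ?q_gt1.
Qed.

(** With the numerator of the Gaussian binomial in reverse order, this is factor
    by factor [(y * x - 1) / x < y] with [y = q ^ e1] and
    [x = q ^ (i + 1)]. *)
Lemma omega_gauss_lt e1 e2 : (1 <= e2)%N -> d = (e1 + e2)%N ->
  omega R q e2 * gauss_binomial R q d e2 < q%:R ^+ (e1 * e2).
Proof.
move=> e20 ->; rewrite /omega big_add1 big_mkord /= gauss_binomial_split.
rewrite mulrCA -prodfV -big_split /=.
rewrite -[\prod_(i < e2) (q%:R ^+ (_ - _) - 1)](big_mkord xpredT
  (fun i => q%:R ^+ (e1 + e2 - i) - 1)) big_nat_rev big_mkord add0n -big_split /=.
rewrite exprM -[e2 in ltRHS]card_ord -prodr_const.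
apply: ltr_prod.
  by apply/hasP; exists (Ordinal e20); rewrite ?mem_index_enum.
move=> i _; have qi := qexp_gt1 (n := i.+1) isT.
have q0 : 0 < q%:R ^+ i.+1 :> R by rewrite exprn_gt0 ?q_gt0.
have -> : (e1 + e2 - (e2 - i.+1) = e1 + i.+1)%N by have := ltn_ord i; lia.
rewrite exprD.
have -> : 1 - q%:R ^- i.+1 = (q%:R ^+ i.+1 - 1) / q%:R ^+ i.+1 :> R.
  by rewrite mulrBl divff ?mul1r // lt0r_neq0.
set x := q%:R ^+ i.+1 in qi q0 *; set y := q%:R ^+ e1.
have x1 : x - 1 != 0 by rewrite lt0r_neq0.
have x0 : x != 0 by rewrite lt0r_neq0.
have -> : (y * x - 1) * ((x - 1) / x / (x - 1)) = y - x^-1 by field; rewrite x0 x1.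
rewrite ltrBlDr ltrDl invr_gt0 q0 andbT subr_ge0.
have y1 : 1 <= y by rewrite exprn_ege1 // ltW ?q_gt1.
by apply: le_trans y1; rewrite invf_le1 //; lra.
Qed.

End Gauss.


(** * The expander mixing lemma *)

(** Lagrange's identity: twice the difference of the two sides is a double sum
    of squares. *)
Lemma cauchy_schwarz_sum (R : realDomainType) (I : finType) (P : pred I) (a b : I -> R) :
  (\sum_(i | P i) a i * b i) ^+ 2
    <= (\sum_(i | P i) a i ^+ 2) * (\sum_(i | P i) b i ^+ 2).
Proof.
rewrite -subr_ge0 -(pmulr_lge0 _ (ltr0Sn R 1)).
have -> : ((\sum_(i | P i) a i ^+ 2) * (\sum_(i | P i) b i ^+ 2)
    - (\sum_(i | P i) a i * b i) ^+ 2) * 2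
  = \sum_(i | P i) \sum_(j | P j) (a i * b j - a j * b i) ^+ 2; last first.
  by do 2!apply: sumr_ge0 => ? _; rewrite sqr_ge0.
transitivity (\sum_(i | P i) \sum_(j | P j) (a i ^+ 2 * b j ^+ 2)
  + \sum_(i | P i) \sum_(j | P j) (b i ^+ 2 * a j ^+ 2)
  - (\sum_(i | P i) \sum_(j | P j) ((a i * b i) * (a j * b j))) * 2).
  have prodE (x y : I -> R) : \sum_(i | P i) \sum_(j | P j) (x i * y j)
      = (\sum_(i | P i) x i) * (\sum_(i | P i) y i).
    by rewrite mulr_suml; apply: eq_bigr => i _; rewrite mulr_sumr.
  rewrite (prodE (fun i => a i ^+ 2) (fun j => b j ^+ 2)).
  rewrite (prodE (fun i => b i ^+ 2) (fun j => a j ^+ 2)).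
  rewrite (prodE (fun i => a i * b i) (fun j => a j * b j)); ring.
rewrite mulr_suml -big_split -sumrB /=; apply: eq_bigr => i _.
rewrite mulr_suml -big_split -sumrB /=; apply: eq_bigr => j _; ring.
Qed.

Section Mixing.

Variables (R : realType) (F : finFieldType) (d e1 e2 : nat).
Hypotheses (he : (e1 + e2)%N = d) (he21 : (e2 <= e1)%N).
Notation V := 'rV[F]_d.
Notation q := #|F|.
Implicit Types (S T U W Z : {vspace V}) (f g h : {vspace V} -> R).

Lemma disj_const e Z (c : R) : (e + \dim Z)%N = d ->
  disj e (fun=> c) Z = q%:R ^+ (\dim Z * e) * c.
Proof.
move=> eZ; rewrite -natrX; apply: sum_const_card.
have := @card_complements F d e 0%VS Z; rewrite cap0v dimv0 add0n => <- //.
by apply: eq_card => S; rewrite !inE sub0v.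
Qed.

(** The disjointness graph is regular of degree [q ^ (e1 * e2)] on both
    sides. *)
Lemma card_subspaces_compl : #|subspaces F d e1| = #|subspaces F d e2|.
Proof.
have qk : (0 < q ^ (e1 * e2))%N by rewrite expn_gt0 card_field_gt0.
apply/eqP; rewrite -(eqn_pmul2r qk); apply/eqP.
apply: (@double_count _ _ [in subspaces F d e1] [in subspaces F d e2]
  (fun Z S => (S :&: Z)%VS == 0%VS)) => Z /=; rewrite inE => /eqP dZ.
  have := @card_complements F d e2 0%VS Z; rewrite cap0v dimv0 add0n dZ => <- //.
    by apply: eq_card => S; rewrite !inE sub0v.
  by rewrite addnC.
have := @card_complements F d e1 0%VS Z; rewrite cap0v dimv0 add0n dZ mulnC => <- //.
by apply: eq_card => S; rewrite !inE sub0v capvC.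
Qed.

Lemma sum_subspaces_const e (c : R) :
  \sum_(S : {vspace V} | \dim S == e) c = #|subspaces F d e|%:R * c.
Proof. by apply: sum_const_card; apply: eq_card => S; rewrite !inE. Qed.

Lemma sum_indicator e (Y : {set {vspace V}}) f : Y \subset subspaces F d e ->
  \sum_(S | \dim S == e) (S \in Y)%:R * f S = \sum_(S in Y) f S.
Proof.
move=> /subsetP sY; rewrite big_mkcond [RHS]big_mkcond; apply: eq_bigr => S _.
case: (boolP (S \in Y)) => SY; last by rewrite mul0r; case: (_ == _).
by have := sY _ SY; rewrite inE mul1r => ->.
Qed.

Lemma sum_centered e (Y : {set {vspace V}}) (a : R) : Y \subset subspaces F d e ->
  #|Y|%:R = a * #|subspaces F d e|%:R ->
  \sum_(S : {vspace V} | \dim S == e) ((S \in Y)%:R - a) = 0.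
Proof.
move=> sY aY; rewrite sumrB sum_subspaces_const.
under eq_bigr => S _ do rewrite -[_%:R]mulr1.
by rewrite sum_indicator // sumr_const aY mulrC subrr.
Qed.

Lemma sum_centered_sqr e (Y : {set {vspace V}}) (a : R) : Y \subset subspaces F d e ->
  #|Y|%:R = a * #|subspaces F d e|%:R ->
  \sum_(S : {vspace V} | \dim S == e) ((S \in Y)%:R - a) ^+ 2 = #|Y|%:R * (1 - a).
Proof.
move=> sY aY.
transitivity (\sum_(S : {vspace V} | \dim S == e)
    ((S \in Y)%:R * (1 - a) - a * ((S \in Y)%:R - a))).
  by apply: eq_bigr => S _; case: (S \in Y) => /=; ring.
rewrite sumrB -mulr_sumr sum_centered // mulr0 subr0 sum_indicator //.
exact: sum_const_card.
Qed.

Lemma card_disjoint_pairs (Y1 Y2 : {set {vspace V}}) :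
  Y1 \subset subspaces F d e1 -> Y2 \subset subspaces F d e2 ->
  #|disjoint_pairs Y1 Y2|%:R =
    \sum_(Z | \dim Z == e1) (Z \in Y1)%:R * disj e2 (fun S => (S \in Y2)%:R) Z :> R.
Proof.
move=> s1 s2; rewrite sum_indicator // /disj.
under eq_bigr => Z _.
  rewrite big_mkcondr /=.
  under eq_bigr => S _.
    rewrite (_ : (if _ then _ else _) =
      (S \in Y2)%:R * (((Z :&: S)%VS == 0%VS)%:R : R)); last first.
      by rewrite capvC; case: (_ == _); rewrite ?mulr1 ?mulr0.
    over.
  rewrite sum_indicator //.
  over.
rewrite pair_big_dep -sum1_card natr_sum big_mkcond [RHS]big_mkcond /=.
apply: eq_bigr => -[Z S] _; rewrite !inE /=.
by case: (Z \in Y1); case: (S \in Y2); case: (_ == _).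
Qed.

(** The deviation from the expected number of edges is the scalar product of the
    centred indicators through the disjointness operator, which contracts
    functions of sum zero; Cauchy-Schwarz concludes. *)
Lemma expander_mixing (Y1 Y2 : {set {vspace V}}) (a1 a2 : R) :
    Y1 \subset subspaces F d e1 -> Y2 \subset subspaces F d e2 ->
    #|Y1|%:R = a1 * #|subspaces F d e1|%:R -> #|Y2|%:R = a2 * #|subspaces F d e2|%:R ->
  (#|disjoint_pairs Y1 Y2|%:R - q%:R ^+ (e1 * e2) * a2 * #|Y1|%:R) ^+ 2
    <= eigen R F e1 e2 1 * (#|Y1|%:R * (1 - a1)) * (#|Y2|%:R * (1 - a2)).
Proof.
move=> s1 s2 aY1 aY2.
pose h Z : R := (Z \in Y1)%:R - a1; pose f S : R := (S \in Y2)%:R - a2.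
have disjf Z : \dim Z = e1 ->
    disj e2 (fun S => (S \in Y2)%:R) Z = disj e2 f Z + q%:R ^+ (e1 * e2) * a2.
  move=> dZ; have := @disj_const e2 Z a2; rewrite dZ => <-; last by rewrite addnC.
  by rewrite -big_split /=; apply: eq_bigr => S _; rewrite subrK.
have sumf : \sum_(Z | \dim Z == e1) disj e2 f Z = 0.
  under eq_bigr => Z _ do rewrite -[disj _ _ _]mulr1.
  rewrite (disj_adjoint e1 e2 f (fun=> 1)).
  transitivity (\sum_(S | \dim S == e2) f S * q%:R ^+ (e2 * e1)).
    by apply: eq_bigr => S /eqP dS; rewrite disj_const ?dS // mulr1.
  by rewrite -mulr_suml sum_centered // mul0r.
have -> : #|disjoint_pairs Y1 Y2|%:R - q%:R ^+ (e1 * e2) * a2 * #|Y1|%:R =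
    \sum_(Z | \dim Z == e1) h Z * disj e2 f Z.
  under [RHS]eq_bigr => Z _ do rewrite mulrBl.
  rewrite sumrB -mulr_sumr sumf mulr0 subr0 card_disjoint_pairs //.
  transitivity (\sum_(Z | \dim Z == e1)
    ((Z \in Y1)%:R * disj e2 f Z + (Z \in Y1)%:R * (q%:R ^+ (e1 * e2) * a2))
      - q%:R ^+ (e1 * e2) * a2 * #|Y1|%:R).
    congr (_ - _); apply: eq_bigr => Z /eqP dZ; rewrite disjf //; ring.
  rewrite big_split /= (sum_indicator (fun=> q%:R ^+ (e1 * e2) * a2)) //.
  by rewrite sumr_const -(mulr_natr (q%:R ^+ (e1 * e2) * a2)) addrK.
apply: le_trans (cauchy_schwarz_sum _ _ _) _.
rewrite (sum_centered_sqr s1 aY1) -(sum_centered_sqr s2 aY2) [leRHS]mulrAC [leRHS]mulrC.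
rewrite ler_wpM2l //.
  by rewrite -(sum_centered_sqr s1 aY1); apply: sumr_ge0 => S _; rewrite sqr_ge0.
by apply: disj_contraction => //; apply: sum_centered.
Qed.

End Mixing.

(** * From the mixing inequality to the proportions *)

(** Here [E] is the number of edges between vertex sets of sizes [y1], [y2] and
    densities [a1], [a2] in a [k]-regular bipartite graph with [N] vertices on
    each side and second singular value [k * p]. *)
Lemma proportion_lower_bound (R : rcfType) (E y1 y2 N k p a1 a2 : R) :
    0 < a1 -> 0 < a2 -> 0 < N -> 0 <= k -> 0 <= p -> y1 = a1 * N -> y2 = a2 * N ->
    (E - k * a2 * y1) ^+ 2 <= (k * p) ^+ 2 * (y1 * (1 - a1)) * (y2 * (1 - a2)) ->
  k / N * (1 - Num.sqrt ((1 / a1 - 1) * (1 / a2 - 1)) * p) <= E / (y1 * y2).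
Proof.
move=> a10 a20 N0 k0 p0 -> ->; set D := (1 / a1 - 1) * (1 / a2 - 1) => le2.
have a1n := lt0r_neq0 a10; have a2n := lt0r_neq0 a20; have Nn := lt0r_neq0 N0.
set x := E / (a1 * N * (a2 * N)) - k / N.
have x2 : x ^+ 2 <= (k * p / N) ^+ 2 * D.
  have c0 : 0 < (a1 * N * (a2 * N)) ^+ 2 by rewrite exprn_gt0 // !mulr_gt0.
  rewrite -(ler_pM2r c0); apply: le_trans (le_trans le2 _); rewrite le_eqVlt.
    by apply/orP; left; apply/eqP; rewrite /x; field; rewrite a1n a2n Nn.
  by apply/orP; left; apply/eqP; rewrite /D; field; rewrite a1n a2n Nn.
have : `|x| <= k * p / N * Num.sqrt D.
  have c0 : 0 <= k * p / N by rewrite !mulr_ge0 // invr_ge0 ltW.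
  by rewrite -sqrtr_sqr -[X in _ <= X * _](ger0_norm c0) -sqrtr_sqr
    -sqrtrM ?sqr_ge0 // ler_wsqrtr.
rewrite ler_norml => /andP[+ _].
have -> : k * p / N * Num.sqrt D = k / N * (Num.sqrt D * p) by ring.
by rewrite /x mulrBr mulr1; lra.
Qed.

(** If [1 - (1 / al - 1) * p] is positive, strictness comes from [w < K]; if it
    is negative, from [0 <= pr]; if it vanishes, from a density exceeding
    [al]. *)
Lemma min_density_bound (R : rcfType) (w K pr al a1 a2 p : R) :
    0 < w -> w < K -> 0 < p -> 0 <= pr -> 0 < al -> al <= a1 -> al <= a2 ->
    a1 <= 1 -> a2 <= 1 ->
    K * (1 - Num.sqrt ((1 / a1 - 1) * (1 / a2 - 1)) * p) <= pr ->
  w * (1 - (1 / al - 1) * p) <= pr /\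
    (~ [/\ a1 = al, a2 = al & (1 / al - 1) * p = 1] ->
      w * (1 - (1 / al - 1) * p) < pr).
Proof.
move=> w0 wK p0 pr0 al0 al1 al2 a11 a21 Kpr; have K0 := lt_trans w0 wK.
set c := 1 / al - 1; set c1 := 1 / a1 - 1 in Kpr; set c2 := 1 / a2 - 1 in Kpr.
have cP a : al <= a -> a <= 1 -> 0 <= 1 / a - 1 /\ 1 / a - 1 <= c.
  move=> ala a1'; have a0 := lt_le_trans al0 ala.
  rewrite /c !div1r lerD2r subr_ge0 lef_pV2 // ?posrE //; split=> //.
  by rewrite invf_ge1.
have [c10 c1c] := cP _ al1 a11; have [c20 c2c] := cP _ al2 a21.
have c0 : 0 <= c := le_trans c10 c1c.
have sc : Num.sqrt (c1 * c2) <= c.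
  rewrite -[leRHS](ger0_norm c0) -sqrtr_sqr ler_wsqrtr // expr2.
  exact: ler_pM.
have scp : Num.sqrt (c1 * c2) * p <= c * p by rewrite ler_pM2r.
have [B0|B0|B0] := ltrgt0P (1 - c * p).
- have lt : w * (1 - c * p) < pr.
    apply: lt_le_trans Kpr; apply: lt_le_trans (_ : K * (1 - c * p) <= _).
      by rewrite ltr_pM2r.
    by rewrite ler_pM2l //; lra.
  by split=> [|_] //; apply: ltW.
- have lt : w * (1 - c * p) < pr by apply: lt_le_trans pr0; rewrite pmulr_rlt0.
  by split=> [|_] //; apply: ltW.
rewrite B0 mulr0; split=> // ne; apply: lt_le_trans Kpr; rewrite mulr_gt0 // subr_gt0.
have cp : c * p = 1 by lra.
have cpos : 0 < c by rewrite -(pmulr_lgt0 _ p0) cp.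
rewrite -cp ltr_pM2r // -[ltRHS](ger0_norm c0) -sqrtr_sqr ltr_sqrt ?exprn_gt0 //.
have eqc a : 0 < a -> 1 / a - 1 = c -> a = al.
  by move=> a0 /addIr; rewrite !div1r => /invr_inj.
have [e1|n1] := eqVneq c1 c; last first.
  apply: le_lt_trans (_ : _ <= c1 * c) _; first exact: ler_wpM2l.
  by rewrite expr2 ltr_pM2r // lt_neqAle n1.
have n2 : c2 != c.
  apply/eqP => e2; apply: ne; split=> //; apply: eqc => //; exact: lt_le_trans al0 _.
by rewrite e1 expr2 ltr_pM2l // lt_neqAle n2.
Qed.

Lemma powR_half_sqr (R : realType) (x : R) (d : nat) : 0 < x ->
  (x `^ (- (d%:R / 2))) ^+ 2 = (x ^+ d)^-1.
Proof.
move=> x0; rewrite -powR_mulrn ?powR_ge0 // -powRrM mulNr divfK ?pnatr_eq0 //.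
by rewrite powRN powR_mulrn // ltW.
Qed.

(* The strict inequality excludes the case where both densities equal [alpha]
   and the lower bound vanishes: there it can fail. For instance, for
   e1 = e2 = 1, Y1 = Y2 a single line, alpha = 1 / (q + 1), both sides are 0. *)
Theorem proposition1p3 (R : realType) (q : nat) (F : finFieldType)
    (e1 e2 d : nat) (hq : #|F| = q) (he21 : (e2 <= e1)%N) (he2 : (1 <= e2)%N)
    (hd : d = (e1 + e2)%N)
    (Y1 Y2 : {set {vspace 'rV[F]_d}})
    (hY1 : Y1 \subset subspaces F d e1) (hY2 : Y2 \subset subspaces F d e2)
    (hY1n0 : Y1 != set0) (hY2n0 : Y2 != set0) :
  let alpha1 : R := density R Y1 (subspaces F d e1) in
  let alpha2 : R := density R Y2 (subspaces F d e2) in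
  let proportion : R :=
    #|disjoint_pairs Y1 Y2|%:R / (#|Y1|%:R * #|Y2|%:R) in
  let qd2 : R := q%:R `^ (- (d%:R / 2)) in
  [/\ 0 < alpha1 * alpha2,
      proportion >= q%:R ^+ (e1 * e2) / gauss_binomial R q d e1
        * (1 - Num.sqrt ((1 / alpha1 - 1) * (1 / alpha2 - 1)) * qd2)
    & forall alpha : R, Num.min alpha1 alpha2 >= alpha -> alpha > 0 ->
        proportion >= omega R q e2 * (1 - (1 / alpha - 1) * qd2)
        /\ (~ [/\ alpha1 = alpha, alpha2 = alpha & (1 / alpha - 1) * qd2 = 1] ->
            proportion > omega R q e2 * (1 - (1 / alpha - 1) * qd2))].
Proof.
move=> alpha1 alpha2 proportion qd2; subst q.
have hd' : (e1 + e2)%N = d by [].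
have q0 := q_gt0 R F.
have densP e (Y : {set {vspace 'rV[F]_d}}) : Y \subset subspaces F d e -> Y != set0 ->
    [/\ 0 < density R Y (subspaces F d e) , density R Y (subspaces F d e) <= 1,
        0 < #|subspaces F d e|%:R :> R
      & #|Y|%:R = density R Y (subspaces F d e) * #|subspaces F d e|%:R].
  rewrite -card_gt0 /density => sY Y0; have YX := subset_leq_card sY.
  have X0 : 0 < #|subspaces F d e|%:R :> R by rewrite ltr0n (leq_trans Y0).
  split=> //; first by rewrite divr_gt0 // ltr0n.
    by rewrite ler_pdivrMr // mul1r ler_nat.
  by rewrite divfK // lt0r_neq0.
have [a10 a11 N0 aY1] := densP _ _ hY1 hY1n0; have [a20 a21 _ aY2] := densP _ _ hY2 hY2n0.
have p0 : 0 < qd2 by rewrite powR_gt0.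
have N12 := card_subspaces_compl F hd'.
have k0 : 0 < #|F|%:R ^+ (e1 * e2) :> R by rewrite exprn_gt0.
have eig : eigen R F e1 e2 1 = (#|F|%:R ^+ (e1 * e2) * qd2) ^+ 2.
  rewrite exprMn powR_half_sqr // -(eigen_one R F he2 he21) hd'.
  by rewrite mulfK // expf_neq0 // lt0r_neq0.
have main : #|F|%:R ^+ (e1 * e2) / gauss_binomial R #|F| d e1
    * (1 - Num.sqrt ((1 / alpha1 - 1) * (1 / alpha2 - 1)) * qd2) <= proportion.
  rewrite -card_subspaces.
  apply: (proportion_lower_bound (N := #|subspaces F d e1|%:R)) => //.
  - exact: ltW.
  - exact: ltW.
  - by rewrite N12.
  by rewrite -eig; apply: expander_mixing.
split=> // [|alpha]; first exact: mulr_gt0.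
rewrite le_min => /andP[le1 le2] alpha0.
apply: (min_density_bound _ _ _ _ _ _ _ _ _ main) => //.
- exact: omega_gt0.
- rewrite -card_subspaces ltr_pdivlMr // N12 card_subspaces.
  exact: omega_gauss_lt.
- by rewrite divr_ge0 // mulr_ge0.
Qed.
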